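(* Let $m,n\ge 1$, let $X_0\in\mathbb{R}^{m\times n}$ be a rank-one matrix all of whose entries are nonzero, and let $\Omega\subseteq\{1,\dots,m\}\times\{1,\dots,n\}$ be such that the bipartite graph $\mathcal{G}$ associated with $\Omega$ is connected. Then the problem of recovering $X_0$ from its entries $(X_0)_{ij}$, $(i,j)\in\Omega$, is solved exactly by the second-order (two rounds) semidefinite relaxation with trace minimization: the moment matrix $M_0=m_0m_0^T$ is the unique optimal solution of the semidefinite program $$\min_M\ \operatorname{Tr}(M)\quad\text{subject to}\quad M\succeq 0,\quad M\ \text{is a structured moment matrix with } M_{0,0}=1,\quad L_M(h_{ij}\,z^\kappa)=0\ \text{ for all }(i,j)\in\Omega,\ |\kappa|\le 2$$ (so that the entries of $X_0$ can be read off from those of its solution).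
   Context: Bipartite graph: $\mathcal{G}$ has vertex set consisting of the $m$ row indices and the $n$ column indices, with an edge between row $i$ and column $j$ iff $(i,j)\in\Omega$. Normalization: write $X_0=x_0y_0^T$ with $(x_0)_1=1$ (possible and unique since all entries of $X_0$ are nonzero). Let $K=m+n-1$ and consider the variables $z=(x_2,\dots,x_m,y_1,\dots,y_n)\in\mathbb{R}^K$, with $z_0=((x_0)_2,\dots,(x_0)_m,(y_0)_1,\dots,(y_0)_n)$. For $\alpha\in\mathbb{N}^K$ write $z^\alpha=\prod_k z_k^{\alpha_k}$, $|\alpha|=\sum_k\alpha_k$, and $\mathbb{N}^K_2=\{\alpha\in\mathbb{N}^K:|\alpha|\le 2\}$. Constraint polynomials: for $(i,j)\in\Omega$, $h_{ij}(z)=y_j-(X_0)_{1j}$ if $i=1$, and $h_{ij}(z)=x_iy_j-(X_0)_{ij}$ if $i\ge 2$. Moment matrices: $M$ ranges over real symmetric matrices with rows and columns indexed by $\mathbb{N}^K_2$. $M$ is a structured moment matrix if $M_{\alpha,\beta}=M_{\alpha',\beta'}$ whenever $\alpha+\beta=\alpha'+\beta'$; for $|\gamma|\le 4$ the common value of $M_{\alpha,\beta}$ with $\alpha+\beta=\gamma$ is denoted $m_\gamma$, and for a polynomial $p(z)=\sum_{|\gamma|\le 4}p_\gamma z^\gamma$ we put $L_M(p)=\sum_\gamma p_\gamma m_\gamma$. Finally $m_0=(z_0^\alpha)_{\alpha\in\mathbb{N}^K_2}$ and $M_0=m_0m_0^T$. *)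

(* Defs.v *)
From mathcomp Require Export all_boot all_order all_algebra.
From mathcomp Require Export reals.
From mathcomp Require Export mpoly.

Set Implicit Arguments.
Unset Strict Implicit.
Unset Printing Implicit Defensive.

Import Order.TTheory GRing.Theory Num.Theory.
Local Open Scope ring_scope.

(* Throughout, matrices have m.+1 >= 1 rows and n.+1 >= 1 columns, indexed from
   0, so the row used for the normalization is [ord0]. *)

Definition bip_edge (m n : nat) (Omega : {set 'I_m * 'I_n}) :
    rel ('I_m + 'I_n) :=
  fun u v => match u, v with
  | inl i, inr j | inr j, inl i => (i, j) \in Omega
  | _, _ => false
  end.

Definition bip_connected (m n : nat) (Omega : {set 'I_m * 'I_n}) : Prop :=
  forall u v, connect (bip_edge Omega) u v.

Definition normalized_factors (R : realType) (m n : nat)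
    (X : 'M[R]_(m.+1, n.+1)) (x : 'cV[R]_m.+1) (y : 'cV[R]_n.+1) : Prop :=
  X = x *m y^T /\ x ord0 0 = 1.

Lemma normalized_factors_exist (R : realType) (m n : nat)
    (X : 'M[R]_(m.+1, n.+1)) :
  \rank X = 1%N -> (forall i j, X i j != 0) ->
  exists x y, normalized_factors X x y.
Proof.
move=> rX nzX.
have [u [v defX]] : exists u : 'cV[R]_m.+1, exists v : 'rV[R]_n.+1, X = u *m v.
  move: (col_base X) (row_base X) (mulmx_base X); rewrite rX => u v <-.
  by exists u, v.
have XE i j : X i j = u i 0 * v 0 j by rewrite defX mxE big_ord1.
have nzu : u ord0 0 != 0.
  by apply: contraNneq (nzX ord0 ord0) => u0; rewrite XE u0 mul0r.
exists ((u ord0 0)^-1 *: u), (u ord0 0 *: v^T); split.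
  by rewrite linearZ /= trmxK -scalemxAl -scalemxAr scalerA mulVf // scale1r.
by rewrite mxE mulVf.
Qed.

Lemma normalized_factors_uniq (R : realType) (m n : nat)
    (X : 'M[R]_(m.+1, n.+1)) x y x' y' :
  (forall i j, X i j != 0) ->
  normalized_factors X x y -> normalized_factors X x' y' -> x = x' /\ y = y'.
Proof.
move=> nzX [defX x1] [defX' x1'].
have XE i j : X i j = x i 0 * y j 0 by rewrite defX mxE big_ord1 mxE.
have XE' i j : X i j = x' i 0 * y' j 0 by rewrite defX' mxE big_ord1 mxE.
have yy' j : y j 0 = y' j 0.
  by move: (XE ord0 j); rewrite XE' x1 x1' !mul1r.
split; apply/colP => k; last exact: yy'.
have nzy : y ord0 0 != 0.
  by apply: contraNneq (nzX k ord0) => y0; rewrite XE y0 mulr0.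
by apply: (mulIf nzy); rewrite -XE yy' -XE'.
Qed.

(* The m + n.+1 variables are z = (x_1, ..., x_m, y_0, ..., y_n), with x_0
   replaced by the constant 1. *)

Definition xvar (R : realType) (m n : nat) (i : 'I_m.+1) :
    {mpoly R[m + n.+1]} :=
  if unlift ord0 i is Some k then 'X_(lshift n.+1 k) else 1.

Definition yvar (R : realType) (m n : nat) (j : 'I_n.+1) :
    {mpoly R[m + n.+1]} :=
  'X_(rshift m j).

Definition hpoly (R : realType) (m n : nat) (X : 'M[R]_(m.+1, n.+1))
    (i : 'I_m.+1) (j : 'I_n.+1) : {mpoly R[m + n.+1]} :=
  xvar R n i * yvar R m j - (X i j)%:MP.

Definition zpoint (R : realType) (m n : nat)
    (x : 'cV[R]_m.+1) (y : 'cV[R]_n.+1) : 'I_(m + n.+1) -> R :=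
  fun k => match split k with
  | inl i => x (lift ord0 i) 0
  | inr j => y j 0
  end.

(* Multi-indices of degree <= 2 in K variables form the finite type
   'X_{1..K < 3}; [enum_rank] and [enum_val] translate between them and the
   row/column indices of a moment matrix. *)

Definition nmon2 (K : nat) : nat := #|{: 'X_{1..K < 3}}|.

Definition mentry (R : realType) (K : nat) (M : 'M[R]_(nmon2 K))
    (a b : 'X_{1..K < 3}) : R :=
  M (enum_rank a) (enum_rank b).

Definition mvec (R : realType) (K : nat) (z : 'I_K -> R) : 'cV[R]_(nmon2 K) :=
  \col_a \prod_(k < K) z k ^+ (enum_val a : 'X_{1..K < 3}) k.

Definition psdmx (R : realType) (N : nat) (A : 'M[R]_N) : Prop :=
  A^T = A /\ forall v : 'cV[R]_N, 0 <= (v^T *m A *m v) 0 0.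

Definition structured (R : realType) (K : nat) (M : 'M[R]_(nmon2 K)) : Prop :=
  forall a b a' b' : 'X_{1..K < 3},
    (a + b)%MM = (a' + b')%MM -> mentry M a b = mentry M a' b'.

(* The entry of M at some (a, b) with a + b = g; such a pair exists iff
   mdeg g <= 4, and by [momentE] the choice is irrelevant when M is
   structured. *)
Definition moment (R : realType) (K : nat) (M : 'M[R]_(nmon2 K))
    (g : 'X_{1..K}) : R :=
  if [pick ab : 'X_{1..K < 3} * 'X_{1..K < 3} | (ab.1 + ab.2)%MM == g]
  is Some ab then mentry M ab.1 ab.2 else 0.

Lemma momentE (R : realType) (K : nat) (M : 'M[R]_(nmon2 K))
    (a b : 'X_{1..K < 3}) :
  structured M -> moment M (a + b)%MM = mentry M a b.
Proof.
move=> sM; rewrite /moment; case: pickP => [ab /eqP|/(_ (a, b))].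
  exact: sM.
by rewrite eqxx.
Qed.

(* Only meaningful on polynomials of degree at most 4. *)
Definition riesz (R : realType) (K : nat) (M : 'M[R]_(nmon2 K))
    (p : {mpoly R[K]}) : R :=
  \sum_(g <- msupp p) p@_g * moment M g.

Definition feasible (R : realType) (m n : nat) (X : 'M[R]_(m.+1, n.+1))
    (Omega : {set 'I_m.+1 * 'I_n.+1}) (M : 'M[R]_(nmon2 (m + n.+1))) : Prop :=
  [/\ psdmx M,
      structured M,
      mentry M bm0 bm0 = 1
    & forall (i : 'I_m.+1) (j : 'I_n.+1) (kappa : 'X_{1..m + n.+1}),
        (i, j) \in Omega -> (mdeg kappa <= 2)%N ->
        riesz M (hpoly X i j * 'X_[kappa]) = 0].

Definition optimal (R : realType) (m n : nat) (X : 'M[R]_(m.+1, n.+1))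
    (Omega : {set 'I_m.+1 * 'I_n.+1}) (M : 'M[R]_(nmon2 (m + n.+1))) : Prop :=
  feasible X Omega M /\
  forall M', feasible X Omega M' -> \tr M <= \tr M'.

(* Main.v *)
Require Import Defs.
From mathcomp Require Import ring lra.
Set Implicit Arguments.
Unset Strict Implicit.
Unset Printing Implicit Defensive.
Import Order.TTheory GRing.Theory Num.Theory.
Local Open Scope ring_scope.

(** Each vertex of the bipartite graph carries a monomial of degree at most 1
    (1 for the first row, x_i for another row, y_j for a column) and a target
    value; every constraint of the program says that along an edge the product
    of the two monomials equals the product of the two values.  Write mu for
    the moments of a feasible M.

    The key tool is [psdmx_row_eq]: if the quadratic form of a positive
    semidefinite M vanishes at e_a - c e_0, then row a of M is c times row 0.
    Call a vertex u determined if mu (w_u + k) = v_u mu k for all |k| <= 2,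
    where w_u and v_u are its monomial and its value.  If u is determined and
    u v is an edge, the constraint gives mu (w_v + k) = v_v mu k, but only for
    |k| <= 1 since w_u has to be eliminated next to w_v + k.  That is enough
    to make the quadratic form vanish at e_(w_v) - v_v e_0, and [psdmx_row_eq]
    restores the missing degree ([determined_step]).  The first row being trivially
    determined, connectivity determines all variables, hence all moments of
    degree at most 2 agree with those of the point z0 ([feasible_low_moment]).

    The moments of degree 4 are in general not determined by the constraints;
    this is where the trace enters.  Positivity at e_a - z0^a e_0 gives
    M_aa >= (z0^a)^2, so the trace of M is at least that of M0.  If M is
    optimal, equality holds for every a, and [psdmx_row_eq] applied once more
    gives M_ab = z0^a M_0b = z0^a z0^b. *)

(** * Positive semidefinite matrices *)

Section PositiveSemidefinite.
Variables (R : realType) (N : nat).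
Implicit Types (A : 'M[R]_N) (v w : 'cV[R]_N).

Lemma psdmx_sym A i j : psdmx A -> A i j = A j i.
Proof. by case=> symA _; rewrite -{1}symA mxE. Qed.

(** Isotropic vectors of a positive semidefinite form lie in its radical. *)
Lemma psdmx_isotropic A v :
  psdmx A -> (v^T *m A *m v) 0 0 = 0 -> v^T *m A = 0.
Proof.
move=> [symA posA] v0; apply/rowP => j; rewrite [RHS]mxE.
pose w : 'cV[R]_N := delta_mx j 0; set b := (v^T *m A) 0 j.
have bE : (v^T *m A *m w) 0 0 = b by rewrite -colE mxE.
have bE' : (w^T *m A *m v) 0 0 = b.
  by rewrite -bE -[in RHS](trmxK (v^T *m A *m w)) [RHS]mxE !trmx_mul trmxK symA
             mulmxA.
pose q := (w^T *m A *m w) 0 0.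
have q1 : 0 < q + 1 by rewrite ltr_pwDr ?ltr01 ?posA.
(* For t := - b / (q + 1), the form at v + t w is
   2 t b + t^2 q = - b^2 (q + 2) / (q + 1)^2. *)
pose t := - b / (q + 1).
have := posA (v + t *: w).
have -> : ((v + t *: w)^T *m A *m (v + t *: w)) 0 0 =
          t * b + t * (b + t * q).
  rewrite [(v + _)^T]raddfD /= [(t *: w)^T]linearZ /= !mulmxDl !mulmxDr.
  rewrite -!scalemxAl -!scalemxAr.
  have addE (B C : 'M[R]_1) : (B + C) 0 0 = B 0 0 + C 0 0 by rewrite mxE.
  have scaleE s (B : 'M[R]_1) : (s *: B) 0 0 = s * B 0 0 by rewrite mxE.
  rewrite !(addE, scaleE) v0 bE bE' -/q.
  by ring.
have tE : t * (q + 1) = - b by rewrite /t divfK ?gt_eqF.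
clearbody b q t; clear bE bE'; move=> qge0; have {}tE : b = - (t * (q + 1)).
  by rewrite tE opprK.
have /eqP : t ^+ 2 = 0 by subst b; nra.
by rewrite sqrf_eq0 tE => /eqP ->; rewrite mul0r oppr0.
Qed.

(** The quadratic form at [e_i - c e_k]. *)
Lemma quadform_delta A i k c : psdmx A ->
  let v := delta_mx i 0 - c *: delta_mx k 0 : 'cV[R]_N in
  (v^T *m A *m v) 0 0 = A i i - 2%:R * c * A i k + c ^+ 2 * A k k.
Proof.
move=> psdA v; have symA := psdmx_sym i k psdA.
rewrite /v [(_ - _)^T]raddfB /= [(c *: _)^T]linearZ /= !trmx_delta mulmxBl.
rewrite -scalemxAl -!rowE mulmxBr -scalemxAr -!colE !mxE -symA.
by ring.
Qed.

Lemma psdmx_diag_ge A i k c : psdmx A ->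
  0 <= A i i - 2%:R * c * A i k + c ^+ 2 * A k k.
Proof. by move=> psdA; rewrite -quadform_delta //; case: psdA => _; apply. Qed.

Lemma psdmx_row_eq A i k c : psdmx A ->
  A i i - 2%:R * c * A i k + c ^+ 2 * A k k = 0 ->
  forall j, A i j = c * A k j.
Proof.
move=> psdA; rewrite -quadform_delta // => /(psdmx_isotropic psdA) + j.
rewrite [(_ - _)^T]raddfB /= [(c *: _)^T]linearZ /= !trmx_delta mulmxBl.
rewrite -scalemxAl -!rowE.
by move=> /rowP/(_ j); rewrite !mxE => /eqP; rewrite subr_eq0 => /eqP.
Qed.

Lemma psdmx_rank1 v : psdmx (v *m v^T).
Proof.
split=> [|w]; first by rewrite trmx_mul trmxK.
have -> : w^T *m (v *m v^T) *m w = (v^T *m w)^T *m (v^T *m w).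
  by rewrite trmx_mul trmxK !mulmxA.
by rewrite mxE big_ord1 [_^T _ _]mxE -expr2 sqr_ge0.
Qed.

End PositiveSemidefinite.

(** * The Riesz functional *)

Section Riesz.
Variables (R : realType) (K : nat) (M : 'M[R]_(nmon2 K)).

(** The Riesz functional may be summed over any finite set of monomials
    containing the support, which makes its linearity visible. *)
Lemma riesz_wide (s : seq 'X_{1..K}) (p : {mpoly R[K]}) :
  uniq s -> {subset msupp p <= s} ->
  riesz M p = \sum_(g <- s) p@_g * moment M g.
Proof.
move=> us ps; rewrite (bigID (mem (msupp p))) /= [X in _ + X]big1 => [|g].
  rewrite addr0 -big_filter; apply/perm_big/uniq_perm => [||g].
  - exact: msupp_uniq.
  - exact: filter_uniq.
  by rewrite mem_filter andb_idr //; apply: ps.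
by rewrite -mcoeff_eq0 => /eqP ->; rewrite mul0r.
Qed.

Lemma rieszX g : riesz M 'X_[g] = moment M g.
Proof. by rewrite /riesz msuppX big_seq1 mcoeffX eqxx mul1r. Qed.

Lemma rieszBZ c p q : riesz M (p - c *: q) = riesz M p - c * riesz M q.
Proof.
pose s := undup (msupp p ++ msupp q); have us : uniq s := undup_uniq _.
rewrite !(riesz_wide us).
- rewrite mulr_sumr -sumrB; apply: eq_bigr => g _.
  by rewrite mcoeffB mcoeffZ mulrBl mulrA.
- by move=> g gq; rewrite mem_undup mem_cat gq orbT.
- by move=> g gp; rewrite mem_undup mem_cat gp.
move=> g; rewrite mem_undup mem_cat !mcoeff_msupp mcoeffB mcoeffZ.
apply: contraR; rewrite negb_or !negbK => /andP[/eqP -> /eqP ->].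
by rewrite mulr0 subrr.
Qed.

Lemma mentry_enum i j : mentry M (enum_val i) (enum_val j) = M i j.
Proof. by rewrite /mentry !enum_valK. Qed.

End Riesz.

(** * Evaluation of monomials *)

Section MonomialValue.
Variables (R : realType) (K : nat) (z : 'I_K -> R).

(** The value [z ^ g] of a monomial at a point. *)
Definition monval (g : 'X_{1..K}) : R := \prod_(k < K) z k ^+ g k.

Lemma monvalD g h : monval (g + h)%MM = monval g * monval h.
Proof.
by rewrite -big_split; apply: eq_bigr => k _; rewrite mnmDE exprD.
Qed.

Lemma monval0 : monval 0%MM = 1.
Proof. by rewrite /monval big1 // => k _; rewrite mnm0E. Qed.

Lemma monvalU k : monval U_(k)%MM = z k.
Proof.
rewrite /monval (bigD1 k) //= mnm1E eqxx expr1 big1 ?mulr1 // => i nik.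
by rewrite mnm1E eq_sym (negPf nik).
Qed.

Lemma mentry_rank1 (a b : 'X_{1..K < 3}) :
  mentry (mvec z *m (mvec z)^T) a b = monval a * monval b.
Proof. by rewrite /mentry mxE big_ord1 !mxE !enum_rankK. Qed.

Lemma structured_rank1 : structured (mvec z *m (mvec z)^T).
Proof. by move=> a b a' b' eqab; rewrite !mentry_rank1 -!monvalD eqab. Qed.

(** The split of the exponent into two halves of degree at most 2 ensures that
    its moment is an entry of the matrix, not the default value. *)
Lemma moment_rank1 (a b : 'X_{1..K}) :
  (mdeg a <= 2)%N -> (mdeg b <= 2)%N ->
  moment (mvec z *m (mvec z)^T) (a + b)%MM = monval a * monval b.
Proof.
move=> da db; rewrite -[a]/(val (BMultinom (da : (mdeg a < 3)%N))).
rewrite -[b]/(val (BMultinom (db : (mdeg b < 3)%N))).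
by rewrite momentE ?mentry_rank1 //; apply: structured_rank1.
Qed.

End MonomialValue.

(** * Propagation along the graph *)

Section Completion.
Variables (R : realType) (m n : nat) (X : 'M[R]_(m.+1, n.+1)).
Variables (Omega : {set 'I_m.+1 * 'I_n.+1}).
Variables (x : 'cV[R]_m.+1) (y : 'cV[R]_n.+1).
Hypothesis nzX : forall i j, X i j != 0.
Hypothesis normX : normalized_factors X x y.

Local Notation K := (m + n.+1)%N.
Local Notation z := (zpoint x y).
Local Notation vertex := ('I_m.+1 + 'I_n.+1)%type.

(** The monomial attached to a vertex; it is trivial for the first row. *)
Definition vmon (u : vertex) : 'X_{1..K} :=
  match u with
  | inl i => if unlift ord0 i is Some k then U_(lshift n.+1 k)%MM else 0%MM
  | inr j => U_(rshift m j)%MM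
  end.

(** The value that the monomial of a vertex takes at the point [z]. *)
Definition vval (u : vertex) : R :=
  match u with inl i => x i 0 | inr j => y j 0 end.

Lemma entryE i j : X i j = vval (inl i) * vval (inr j).
Proof. by case: normX => -> _; rewrite mxE big_ord1 mxE. Qed.

Lemma vval_neq0 u : vval u != 0.
Proof.
case: u => [i|j]; [have := nzX i ord0 | have := nzX ord0 j];
  by rewrite entryE mulf_eq0 negb_or => /andP[].
Qed.

Lemma mdeg_vmon u : (mdeg (vmon u) <= 1)%N.
Proof.
case: u => [i|j] /=; last by rewrite mdeg1.
by case: unliftP => [k _|_]; rewrite ?mdeg1 ?mdeg0.
Qed.

Lemma monval_vmon u : monval z (vmon u) = vval u.
Proof.
case: u => [i|j] /=; last first.
  by rewrite monvalU /zpoint (unsplitK (inr _ j)).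
case: unliftP => [k ->|->].
  by rewrite monvalU /zpoint (unsplitK (inl _ k)).
by rewrite monval0; case: normX => _ ->.
Qed.

Lemma xyvarE i j :
  xvar R n i * yvar R m j = 'X_[(vmon (inl i) + vmon (inr j))%MM].
Proof.
rewrite mpolyXD; congr (_ * _); rewrite /xvar /=.
by case: unlift => // ; rewrite mpolyX0.
Qed.

Lemma riesz_hpoly (M : 'M[R]_(nmon2 K)) i j k :
  riesz M (hpoly X i j * 'X_[k]) =
  moment M (vmon (inl i) + vmon (inr j) + k)%MM - X i j * moment M k.
Proof.
by rewrite /hpoly xyvarE mulrBl -mpolyXD mul_mpolyC rieszBZ !rieszX.
Qed.

Lemma feasible_rank1 : feasible X Omega (mvec z *m (mvec z)^T).
Proof.
split; [exact: psdmx_rank1 | exact: structured_rank1 | |].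
  by rewrite mentry_rank1 monval0 mulr1.
move=> i j k _ dk; rewrite riesz_hpoly moment_rank1 //; last first.
  by rewrite mdegD (leq_add (mdeg_vmon _) (mdeg_vmon _)).
rewrite -[X in moment _ X]add0m moment_rank1 ?mdeg0 // monval0 mul1r.
by rewrite monvalD !monval_vmon entryE subrr.
Qed.

Section Feasible.
Variable M : 'M[R]_(nmon2 K).
Hypothesis feasM : feasible X Omega M.

Lemma feasible_moment0 : moment M 0%MM = 1.
Proof.
case: feasM => _ sM <- _; rewrite -momentE //=.
by rewrite add0m.
Qed.

Lemma feasible_edge u v k : bip_edge Omega u v -> (mdeg k <= 2)%N ->
  moment M (vmon u + vmon v + k)%MM = vval u * vval v * moment M k.
Proof.
case: feasM => _ _ _ hM.
case: u v => [i|j] [i'|j'] //= e dk; have := hM _ _ _ e dk;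
  rewrite riesz_hpoly entryE => /eqP; rewrite subr_eq0 => /eqP //=.
by rewrite [(U_(_) + _)%MM]addmC => ->; rewrite [y _ _ * _]mulrC.
Qed.

(** Kernel property of the moment matrix: if a monomial of degree at most 2 has
    moment [c] and its square has moment [c ^+ 2], then it may be replaced by
    [c] in its product with any monomial of degree at most 2. *)
Lemma feasible_subst (a : 'X_{1..K}) c :
  (mdeg a <= 2)%N -> moment M a = c -> moment M (a + a)%MM = c ^+ 2 ->
  forall k, (mdeg k <= 2)%N -> moment M (a + k)%MM = c * moment M k.
Proof.
move=> da Ma Maa k dk; case: (feasM) => psdM _ _ _.
pose a' := BMultinom (da : (mdeg a < 3)%N).
pose k' := BMultinom (dk : (mdeg k < 3)%N).
have eM (b b' : 'X_{1..K < 3}) : M (enum_rank b) (enum_rank b') =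
  moment M (b + b')%MM by case: feasM => _ sM _ _; rewrite momentE.
have := @psdmx_row_eq _ _ M (enum_rank a') (enum_rank bm0) c psdM.
rewrite !eM /= addm0 addm0 Ma Maa feasible_moment0.
rewrite mulr1 -mulrA -expr2 mulr_natl mulr2n opprD addrA subrr add0r addNr.
by move=> /(_ erefl) /(_ (enum_rank k')); rewrite !eM /= add0m.
Qed.

(** A vertex is determined if its monomial may be replaced by its value in its
    product with any monomial of degree at most 2. *)
Definition determined (u : vertex) : Prop :=
  forall k, (mdeg k <= 2)%N ->
    moment M (vmon u + k)%MM = vval u * moment M k.

Lemma determined_row0 : determined (inl ord0).
Proof.
by move=> k _; rewrite /= unlift_none add0m; case: normX => _ ->; rewrite mul1r.
Qed.

Lemma determined_step u v :
  bip_edge Omega u v -> determined u -> determined v.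
Proof.
move=> e detu.
(* [u] may be eliminated next to [vmon v + k] only if the latter has degree at
   most 2. *)
have low k : (mdeg k <= 1)%N -> moment M (vmon v + k)%MM = vval v * moment M k.
  move=> dk; apply: (mulfI (vval_neq0 u)).
  rewrite mulrA -feasible_edge ?(leq_trans dk) // -addmA detu //.
  by rewrite mdegD (leq_add (mdeg_vmon v) dk).
have vE : moment M (vmon v) = vval v.
  by rewrite -[vmon v]addm0 low ?mdeg0 // feasible_moment0 mulr1.
apply: feasible_subst => //; first exact: leq_trans (mdeg_vmon v) _.
by rewrite low ?mdeg_vmon // vE.
Qed.

Hypothesis connOmega : bip_connected Omega.

Lemma all_determined u : determined u.
Proof.
have /connectP[p + ->] := connOmega (inl ord0) u.
elim: p (inl ord0 : vertex) determined_row0 => //= w p IHp v detv.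
by move=> /andP[/determined_step/(_ detv) /IHp].
Qed.

Lemma feasible_low_moment k :
  (mdeg k <= 2)%N -> moment M k = monval z k.
Proof.
move: {2}(mdeg k) (erefl (mdeg k)) => d.
elim: d k => [|d IHd] k dk dk2.
  move/eqP: dk; rewrite mdeg_eq0 => /eqP ->.
  by rewrite feasible_moment0 monval0.
have [i ki] : exists i, k i != 0%N.
  apply/existsP; apply: contra_eqT dk => /existsPn k0.
  rewrite mdegE big1 // => i _; exact/eqP/negPn/k0.
have kE : k = (U_(i) + (k - U_(i)))%MM by rewrite addmC submK // lep1mP.
move: kE; set k' := (k - U_(i))%MM => kE.
have dk' : mdeg k' = d by apply/eqP; rewrite -eqSS -dk kE mdegD mdeg1.
have dk2' : (mdeg k' <= 2)%N by rewrite dk' ltnW // -dk.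
have [u iE] : exists u, vmon u = U_(i)%MM.
  case: (split_ordP i) => l ->; last by exists (inr l).
  by exists (inl (lift ord0 l)); rewrite /= liftK.
rewrite kE -iE (all_determined u dk2') IHd // monvalD.
by rewrite monval_vmon.
Qed.

Lemma feasible_diag_ge i : (mvec z *m (mvec z)^T) i i <= M i i.
Proof.
case: (feasM) => psdM sM M00 _.
have := psdmx_diag_ge i (enum_rank bm0) (monval z (enum_val i)) psdM.
have -> : M i (enum_rank bm0) = monval z (enum_val i).
  rewrite -{1}(enum_valK i) -feasible_low_moment; last first.
    by rewrite -ltnS bmdeg.
  by rewrite -[X in moment _ X]addm0 (@momentE _ _ M (enum_val i) bm0).
rewrite -/(mentry M bm0 bm0) M00 mulr1 -mulrA -expr2 mulr_natl mulr2n opprD.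
rewrite addrA subrK subr_ge0 mxE big_ord1 !mxE.
by rewrite expr2.
Qed.

Lemma feasible_trace_ge : \tr (mvec z *m (mvec z)^T) <= \tr M.
Proof. by apply: ler_sum => i _; apply: feasible_diag_ge. Qed.

Lemma feasible_trace_le_eq :
  \tr M <= \tr (mvec z *m (mvec z)^T) -> M = mvec z *m (mvec z)^T.
Proof.
move=> trM; case: (feasM) => psdM sM M00 _.
(* The diagonal of M dominates that of the rank-one matrix, so equal traces
   force equal diagonals. *)
have diagE i : M i i = (mvec z *m (mvec z)^T) i i.
  apply/eqP; rewrite -subr_eq0; apply/eqP; move: i isT.
  apply/psumr_eq0P => [i _|]; first by rewrite subr_ge0 feasible_diag_ge.
  apply/eqP; rewrite sumrB subr_eq0 eq_le trM.
  exact: feasible_trace_ge.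
apply/matrixP => i j; rewrite -(enum_valK i) -(enum_valK j).
rewrite -!/(mentry _ _ _) mentry_rank1 -momentE //.
set a := enum_val i; set b := enum_val j.
have da : (mdeg a <= 2)%N by rewrite -ltnS bmdeg.
have db : (mdeg b <= 2)%N by rewrite -ltnS bmdeg.
rewrite (feasible_subst da (feasible_low_moment da)) //.
  by rewrite feasible_low_moment.
by rewrite momentE // mentry_enum diagE -mentry_enum mentry_rank1 expr2.
Qed.

End Feasible.
End Completion.

Theorem theorem1 (R : realType) (m n : nat) (X0 : 'M[R]_(m.+1, n.+1))
    (Omega : {set 'I_m.+1 * 'I_n.+1})
    (x0 : 'cV[R]_m.+1) (y0 : 'cV[R]_n.+1)
    (rankX0 : \rank X0 = 1%N)
    (nzX0 : forall i j, X0 i j != 0)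
    (connOmega : bip_connected Omega)
    (normX0 : normalized_factors X0 x0 y0) :
  let m0 := mvec (zpoint x0 y0) in
  let M0 := m0 *m m0^T in
  [/\ optimal X0 Omega M0,
      (forall M, optimal X0 Omega M -> M = M0)
    & forall M, optimal X0 Omega M ->
        forall i j, X0 i j = riesz M (xvar R n i * yvar R m j)].
Proof.
move=> m0 M0; have feas0 : feasible X0 Omega M0 := feasible_rank1 Omega normX0.
have uniqM M : optimal X0 Omega M -> M = M0.
  move=> [feasM optM].
  exact: (feasible_trace_le_eq nzX0 normX0 feasM connOmega (optM _ feas0)).
split=> // [|M /uniqM -> i j].
  split=> // M feasM.
  exact: (feasible_trace_ge nzX0 normX0 feasM connOmega).
rewrite xyvarE rieszX moment_rank1 ?(leq_trans (mdeg_vmon _)) //.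
by rewrite !(monval_vmon normX0) -(entryE normX0).
Qed.
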